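(* There exists an absolute constant $c>0$ such that the following holds. Let $n,B,Q\ge 1$ be integers, $\eta>0$, and let $A(k)=(a_{ij}(k))$, $k=0,1,2,\ldots$, be $n\times n$ matrices satisfying the non-vanishing weights assumption with constant $\eta$ and the double stochasticity assumption. Let $x(0)\in\mathbb{R}^n$ be such that every $x_i(0)$ is a multiple of $1/Q$, and let $$x_i(k+1)=\Big\lfloor\sum_{j=1}^n a_{ij}(k)x_j(k)\Big\rfloor,\qquad i=1,\ldots,n,\ k\ge 0,$$ where $\lfloor\cdot\rfloor$ denotes rounding down to the nearest multiple of $1/Q$. Suppose that the relaxed connectivity assumption (with constant $B$) holds. Let $U=\max_i x_i(0)$, $L=\min_i x_i(0)$, and assume $U>L$. Then the common limit $x_f$ of the sequences $x_i(k)$, as $k\to\infty$, satisfies $$\Big|x_f-\frac1n\sum_{i=1}^n x_i(0)\Big|\le\frac{c}{Q}\,\frac{n^2}{\eta}\,B\log\big(Qn(U-L)\big).$$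
   Context: Non-vanishing weights (constant $\eta>0$): for every $k$, $A(k)$ is nonnegative, row-stochastic, has positive diagonal entries, and $a_{ij}(k)>0$ implies $a_{ij}(k)>\eta$. Double stochasticity: for every $k$ and $j$, $\sum_{i=1}^n a_{ij}(k)=1$. Relaxed connectivity (constant $B$): for every integer $\ell\ge 0$, if the nodes are relabeled so that the components of $x(\ell B)$ are in nonincreasing order, $x_1(\ell B)\ge\cdots\ge x_n(\ell B)$, then for every $d\in\{1,\ldots,n-1\}$ either $x_d(\ell B)=x_{d+1}(\ell B)$, or there exist a time $s\in\{\ell B,\ldots,(\ell+1)B-1\}$ and indices $i\in\{1,\ldots,d\}$, $j\in\{d+1,\ldots,n\}$ such that $a_{ij}(s)>0$ or $a_{ji}(s)>0$. Under these hypotheses all components $x_i(k)$ become equal to a common value $x_f$ after finitely many steps. *)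

(* Defs.v *)
From HB Require Import structures.
From mathcomp Require Import all_boot all_order all_algebra all_fingroup.
From mathcomp Require Import all_classical all_reals all_analysis.
Set Implicit Arguments.
Unset Strict Implicit.
Unset Printing Implicit Defensive.
Import Order.TTheory GRing.Theory Num.Theory.
Import numFieldNormedType.Exports.
Local Open Scope ring_scope.

Definition nonvanishing_weights (R : realType) (n : nat) (eta : R)
    (A : nat -> 'M[R]_n) : Prop :=
  forall k : nat,
    [/\ forall i j, 0 <= A k i j,
        forall i, \sum_j A k i j = 1,
        forall i, 0 < A k i i
      & forall i j, 0 < A k i j -> eta < A k i j].

(* Only the column sums: row-stochasticity is in [nonvanishing_weights]. *)
Definition doubly_stochastic (R : realType) (n : nat)
    (A : nat -> 'M[R]_n) : Prop :=
  forall (k : nat) (j : 'I_n), \sum_i A k i j = 1.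

Definition multiple_of_inv (R : realType) (Q : nat) (y : R) : Prop :=
  exists z : int, y = z%:~R / Q%:R.

Definition round_down (R : realType) (Q : nat) (y : R) : R :=
  (Num.floor (y * Q%:R))%:~R / Q%:R.

Definition quantized_iteration (R : realType) (n Q : nat)
    (A : nat -> 'M[R]_n) (x : nat -> 'cV[R]_n) : Prop :=
  forall k : nat, x k.+1 = map_mx (@round_down R Q) (A k *m x k).

(* [s p] is the node that receives label p.+1, and [s] is any relabeling that
   makes the components of [y] nonincreasing (several exist in case of ties). *)
Definition sorting_relabeling (R : realType) (n : nat) (y : 'cV[R]_n)
    (s : 'S_n) : Prop :=
  forall p q : 'I_n, (p <= q)%N -> y (s q) 0 <= y (s p) 0.

(* The cut after the d-th label is given by the consecutive 0-based positions
   p = d - 1 and q = d, so that d ranges over 1, ..., n - 1. *)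
Definition relaxed_connectivity (R : realType) (n B : nat)
    (A : nat -> 'M[R]_n) (x : nat -> 'cV[R]_n) : Prop :=
  forall (l : nat) (s : 'S_n), sorting_relabeling (x (l * B)%N) s ->
  forall p q : 'I_n, q = p.+1 :> nat ->
    x (l * B)%N (s p) 0 = x (l * B)%N (s q) 0 \/
    exists (t : nat) (i j : 'I_n),
      [/\ (l * B <= t < l.+1 * B)%N, (i <= p)%N, (q <= j)%N
        & 0 < A t (s i) (s j) \/ 0 < A t (s j) (s i)].

Definition is_max (R : realType) (n : nat) (y : 'cV[R]_n) (U : R) : Prop :=
  (exists i, y i 0 = U) /\ (forall i, y i 0 <= U).

Definition is_min (R : realType) (n : nat) (y : 'cV[R]_n) (L : R) : Prop :=
  (exists i, y i 0 = L) /\ (forall i, L <= y i 0).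

(* Main.v *)
Require Import Defs.
From HB Require Import structures.
From mathcomp Require Import all_boot all_order all_algebra all_fingroup.
From mathcomp Require Import all_classical all_reals all_analysis.
From mathcomp Require Import ring lra zify.
Set Implicit Arguments.
Unset Strict Implicit.
Unset Printing Implicit Defensive.
Import Order.TTheory GRing.Theory Num.Theory.
Import numFieldNormedType.Exports.
Local Open Scope classical_set_scope.
Local Open Scope ring_scope.

(** Scale by [Q], so that the iterates [z k] are integer vectors, and let
[V k] be the sum of the [(z k i - m k)^2], where [m k] is the least entry of
[z k].  The minimum never decreases, rounding down to at least [m k] only lowers
[V], and before rounding a doubly stochastic step lowers it by the weighted
row variances [1/2 sum_(j,l) a_ij a_il (z_j - z_l)^2].

Order the nodes as at the start of a block of [B] steps.  Until a cut of this
order is first crossed by an edge, its two sides stay on either side of the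
corresponding gap.  At the first crossing, a row with a crossing edge puts mass
at least [eta] on both sides (on one of them by its diagonal entry), hence the
product of the two masses is at least [eta / 2].  Distinct pairs of nodes pay
for all the gaps they span, so a block lowers [V] by [eta / 2] times the sum
of the squared gaps, which by Cauchy-Schwarz is at least [V / n^2].

Thus after more than [4 (n^2 / eta) ln (n Q (U - L))] blocks [V < 1], and by
integrality all the entries agree.  Meanwhile each step lowers the sum of the
entries by at most [n]. *)

(** * Weighted variances and sums of squared gaps *)

(** Lagrange's identity; for total weight 1 the right side is twice the variance of [w] under
    [p]. *)
Lemma sum_sqr_diff (R : realFieldType) (I : finType) (p w : I -> R) :
  \sum_j \sum_k p j * p k * (w j - w k) ^+ 2 =
  2 * ((\sum_j p j) * (\sum_j p j * w j ^+ 2) - (\sum_j p j * w j) ^+ 2).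
Proof.
set s0 := \sum_j p j; set s1 := \sum_j p j * w j.
set s2 := \sum_j p j * w j ^+ 2.
transitivity (\sum_j (p j * w j ^+ 2 * s0 + p j * s2 - 2 * (p j * w j * s1))).
  apply: eq_bigr => j _; rewrite /s0 /s1 /s2 !mulr_sumr -big_split /= -sumrB.
  by apply: eq_bigr => k _; ring.
by rewrite sumrB big_split /= -mulr_sumr -!mulr_suml -/s0 -/s1 -/s2; ring.
Qed.

(** Cauchy-Schwarz: with unit weights the left side of [sum_sqr_diff] is nonnegative. *)
Lemma sqr_sum_le (R : realFieldType) (I : finType) (w : I -> R) :
  (\sum_j w j) ^+ 2 <= #|I|%:R * \sum_j w j ^+ 2.
Proof.
have := sum_sqr_diff (fun=> 1) w.
under [X in _ * (X * _ - _)]eq_bigr do rewrite -[1]/(1%:R : R).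
rewrite -natr_sum sum1_card.
under [X in _ * (_ * X - _)]eq_bigr do rewrite mul1r.
under [X in _ * (_ - X ^+ _)]eq_bigr do rewrite mul1r.
move=> e; rewrite -subr_ge0 -(pmulr_rge0 _ (ltr0n R 2)) -e.
by do 2!apply: sumr_ge0 => ? _; rewrite !mul1r sqr_ge0.
Qed.

(** Unit column sums distribute each [(w j - m) ^+ 2] over the rows. In a row, the second moment
    about [m] is the squared distance of the mean from [m] plus the variance, and [w' i] lies
    between [m] and that mean. *)
Lemma stochastic_step_decrease (R : realFieldType) (I : finType)
    (a : I -> I -> R) (w w' : I -> R) (m : R) :
  (forall i, \sum_j a i j = 1) -> (forall j, \sum_i a i j = 1) ->
  (forall i, m <= w' i) -> (forall i, w' i <= \sum_j a i j * w j) ->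
  \sum_i (w' i - m) ^+ 2
    + 2^-1 * \sum_i \sum_j \sum_k a i j * a i k * (w j - w k) ^+ 2
  <= \sum_i (w i - m) ^+ 2.
Proof.
move=> row col mw' w'le.
have -> : \sum_i (w i - m) ^+ 2 = \sum_i \sum_j a i j * (w j - m) ^+ 2.
  by rewrite exchange_big; apply: eq_bigr => j _; rewrite -mulr_suml col mul1r.
rewrite mulr_sumr -big_split; apply: ler_sum => i _ /=.
have := sum_sqr_diff (a i) (fun j => w j - m).
have -> : \sum_j \sum_k a i j * a i k * (w j - w k) ^+ 2 =
    \sum_j \sum_k a i j * a i k * ((w j - m) - (w k - m)) ^+ 2.
  by do 2!(apply: eq_bigr => ? _); ring.
move=> ->; rewrite row mul1r.
have e : \sum_j a i j * (w j - m) = \sum_j a i j * w j - m.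
  under eq_bigr do rewrite mulrBr.
  by rewrite sumrB -mulr_suml row mul1r.
rewrite e mulKf ?pnatr_eq0 //.
have : (w' i - m) ^+ 2 <= (\sum_j a i j * w j - m) ^+ 2.
  by rewrite lerXn2r ?nnegrE ?subr_ge0 ?lerD2r // (le_trans (mw' i)).
lra.
Qed.

(** The selected gaps, if any, are disjoint intervals between [b] and [a], so they add up to at most
    [a - b]; the square of a sum of nonnegative terms dominates the sum of their squares. *)
Lemma sum_sqr_gaps (R : realFieldType) (v : nat -> R) (P : pred nat)
    (a b : R) (N : nat) :
  (forall d, (d < N)%N -> v d.+1 <= v d) ->
  (forall d, (d < N)%N -> P d -> v d <= a /\ b <= v d.+1) ->
  \sum_(d < N | P d) (v d - v d.+1) ^+ 2 <= (a - b) ^+ 2.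
Proof.
move=> vdec hP.
pose S M := \sum_(d < M | P d) (v d - v d.+1).
have SS M : S M.+1 = S M + (if P M then v M - v M.+1 else 0).
  by rewrite /S big_mkcond big_ord_recr /= -big_mkcond.
have S_ge0 M : (M <= N)%N -> 0 <= S M.
  move=> MN; apply: sumr_ge0 => d _.
  by rewrite subr_ge0 vdec // (leq_trans (ltn_ord d)).
have sumsqr M : (M <= N)%N ->
    \sum_(d < M | P d) (v d - v d.+1) ^+ 2 <= S M ^+ 2.
  elim: M => [|M IH] MN; first by rewrite big_ord0 sqr_ge0.
  rewrite SS big_mkcond big_ord_recr /= -big_mkcond.
  have := IH (ltnW MN); have Sge0 := S_ge0 M (ltnW MN).
  have gap_ge0 : 0 <= v M - v M.+1 by rewrite subr_ge0 vdec.
  case: (P M); last by rewrite !addr0.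
  by have := mulr_ge0 Sge0 gap_ge0; lra.
(* The alternative [S M <= 0] covers an empty selection, which does not relate [v M] to [a]. *)
have SleV M : (M <= N)%N -> S M <= 0 \/ S M <= a - v M.
  elim: M => [|M IH] MN; first by left; rewrite /S big_ord0.
  rewrite SS; have := vdec M MN.
  case: ifP => [/(hP M MN)[]|_].
    by move=> ? ? ?; right; have [] := IH (ltnW MN); lra.
  by have [] := IH (ltnW MN); [left|right]; lra.
have Sle M : (M <= N)%N -> S M <= 0 \/ S M <= a - b.
  elim: M => [|M IH] MN; first by left; rewrite /S big_ord0.
  rewrite SS; have := vdec M MN.
  case: ifP => [/(hP M MN)[]|_]; last by rewrite addr0 => _; exact: IH (ltnW MN).
  by move=> ? ? ?; right; have [] := SleV M (ltnW MN); lra.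
apply: le_trans (sumsqr N (leqnn N)) _.
have S0 := S_ge0 N (leqnn N).
case: (Sle N (leqnn N)) => h.
  by rewrite (@le_anti _ _ (S N) 0) ?h // expr0n sqr_ge0.
by rewrite lerXn2r ?nnegrE // (le_trans S0).
Qed.

(** * Averages rounded down to integers *)

Lemma floor_average_ge (R : realType) (I : finType) (p : I -> R)
    (z : I -> int) (h : int) :
  (forall j, 0 <= p j) -> \sum_j p j = 1 ->
  (forall j, 0 < p j -> h <= z j) ->
  h <= Num.floor (\sum_j p j * (z j)%:~R).
Proof.
move=> p0 p1 hz; rewrite floor_ge_int -[h%:~R]mul1r -[X in X * h%:~R]p1 mulr_suml.
apply: ler_sum => j _; have := p0 j; rewrite le_eqVlt => /predU1P[<-|pj].
  by rewrite !mul0r.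
by apply: ler_wpM2l; rewrite ?(ltW pj) // ler_int hz.
Qed.

Lemma floor_average_le (R : realType) (I : finType) (p : I -> R)
    (z : I -> int) (h : int) :
  (forall j, 0 <= p j) -> \sum_j p j = 1 ->
  (forall j, 0 < p j -> z j <= h) ->
  Num.floor (\sum_j p j * (z j)%:~R) <= h.
Proof.
move=> p0 p1 hz; rewrite -(ler_int R); apply: le_trans (floor_le _) _.
rewrite -[h%:~R]mul1r -[X in X * h%:~R]p1 mulr_suml.
apply: ler_sum => j _; have := p0 j; rewrite le_eqVlt => /predU1P[<-|pj].
  by rewrite !mul0r.
by apply: ler_wpM2l; rewrite ?(ltW pj) // ler_int hz.
Qed.

Definition floor_iteration (R : realType) (n : nat) (A : nat -> 'M[R]_n)
    (z : nat -> 'I_n -> int) : Prop :=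
  forall k i, z k.+1 i = Num.floor (\sum_j A k i j * (z k j)%:~R).

Lemma floor_iteration_ge (R : realType) (n : nat) (eta : R)
    (A : nat -> 'M[R]_n) (z : nat -> 'I_n -> int) (k : nat) (m : int) :
  nonvanishing_weights eta A -> floor_iteration A z ->
  (forall i, m <= z k i) -> forall t i, m <= z (k + t)%N i.
Proof.
move=> hA hz mz; elim=> [|t IH] i; first by rewrite addn0.
have [A0 row _ _] := hA (k + t)%N.
by rewrite addnS hz; apply: floor_average_ge.
Qed.

(** * Cuts of an ordering and the decrease over one block *)

(* [r i] is the position of node [i] in the order at the start of the block;
   the cut [d] separates the positions [<= d] from the positions [> d]. *)
Definition crosses (R : realType) (n : nat) (r : 'I_n -> nat) (M : 'M[R]_n)
    (d : nat) : bool :=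
  [exists i, exists j,
     [&& (r i <= d)%N, (d < r j)%N & (0 < M i j) || (0 < M j i)]].

Definition separates (n : nat) (r : 'I_n -> nat) (d : nat) (j k : 'I_n) :=
  (r j <= d < r k)%N || (r k <= d < r j)%N.

(** In row [i] the separated pairs weigh [2 * (lo i * hi i)], where [lo i] and [hi i] are the row
    masses on the two sides of the cut. All rows contribute nonnegatively, so one row with both
    masses at least [eta] suffices. *)
Lemma cut_weight_ge (R : realType) (n : nat) (eta : R) (M : 'M[R]_n)
    (r : 'I_n -> nat) (d : nat) :
  0 < eta ->
  (forall i j, 0 <= M i j) -> (forall i, \sum_j M i j = 1) ->
  (forall i, 0 < M i i) -> (forall i j, 0 < M i j -> eta < M i j) ->
  crosses r M d ->
  eta <= \sum_i \sum_j \sum_k M i j * M i k * (separates r d j k)%:R.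
Proof.
move=> eta0 M0 row Mii Meta.
pose lo i := \sum_j M i j * (r j <= d)%N%:R.
pose hi i := \sum_j M i j * (d < r j)%N%:R.
have rowE i : \sum_j \sum_k M i j * M i k * (separates r d j k)%:R
              = 2 * (lo i * hi i).
  rewrite (_ : 2 * (lo i * hi i) = lo i * hi i + hi i * lo i); last ring.
  rewrite {1}/lo {2}/hi !mulr_suml -big_split; apply: eq_bigr => j _ /=.
  rewrite /lo /hi !mulr_sumr -big_split; apply: eq_bigr => k _ /=.
  by rewrite /separates; case: (leqP (r j) d); case: (leqP (r k) d) => _ _ /=; ring.
have lo_hi i : lo i + hi i = 1.
  rewrite -(row i) -big_split; apply: eq_bigr => j _ /=.
  by case: leqP => _ /=; ring.
have lo_ge i j : (r j <= d)%N -> M i j <= lo i.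
  move=> jd; rewrite /lo (bigD1 j) //= jd mulr1 lerDl.
  by apply: sumr_ge0 => k _; rewrite mulr_ge0.
have hi_ge i j : (d < r j)%N -> M i j <= hi i.
  move=> jd; rewrite /hi (bigD1 j) //= jd mulr1 lerDl.
  by apply: sumr_ge0 => k _; rewrite mulr_ge0.
have row_ge i : eta <= lo i -> eta <= hi i ->
    eta <= \sum_i \sum_j \sum_k M i j * M i k * (separates r d j k)%:R.
  move=> lo_i hi_i; rewrite (bigD1 i) //=; apply: ler_wpDr.
    by do 3!apply: sumr_ge0 => ? _; rewrite !mulr_ge0.
  (* The larger mass is at least 1/2, the other at least [eta]. *)
  by rewrite rowE; have := lo_hi i; nra.
move=> /existsP[i /existsP[j /and3P[ri rj /orP[] /Meta Mij]]].
(* The row is that of the node whose update uses the edge: its diagonal entry gives mass on its own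
   side, the edge gives mass on the other. *)
- apply: (row_ge i); first by apply: le_trans (lo_ge i i ri); apply/ltW/Meta.
  by apply: le_trans (hi_ge i j rj); apply: ltW.
- apply: (row_ge j); last by apply: le_trans (hi_ge j j rj); apply/ltW/Meta.
  by apply: le_trans (lo_ge j i ri); apply: ltW.
Qed.

(** Without a crossing edge every node averages over its own side only, so the integer bounds
    survive the floor. Only the steps before [b + t] must be uncrossed: the separation still holds
    on entering the step of the first crossing. *)
Lemma uncrossed_cut_separates (R : realType) (n N : nat) (eta : R)
    (A : nat -> 'M[R]_n) (z : nat -> 'I_n -> int) (r : 'I_n -> nat)
    (v : nat -> int) (b d : nat) :
  nonvanishing_weights eta A -> floor_iteration A z ->
  (forall p q, (p <= q <= N)%N -> v q <= v p) ->
  (forall i, (r i <= N)%N) -> (forall i, z b i = v (r i)) -> (d < N)%N ->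
  forall t, (forall u, (u < t)%N -> ~~ crosses r (A (b + u)%N) d) ->
  forall i, ((r i <= d)%N -> v d <= z (b + t)%N i) /\
            ((d < r i)%N -> z (b + t)%N i <= v d.+1).
Proof.
move=> hA hz vdec rN zb dN; elim=> [|t IH] nc i.
  by rewrite addn0 zb; split=> rid; apply: vdec; rewrite ?rid ?rN ?(ltnW dN).
have {}IH := IH (fun u ut => nc u (ltnW ut)).
have ncross j k : (r j <= d)%N -> (d < r k)%N ->
    ~~ (0 < A (b + t)%N j k) /\ ~~ (0 < A (b + t)%N k j).
  move=> rj rk; apply/andP; rewrite -negb_or; apply: contra (nc t (ltnSn t)).
  by move=> h; apply/existsP; exists j; apply/existsP; exists k; rewrite rj rk.
have [A0 row _ _] := hA (b + t)%N.
rewrite addnS hz; split=> ri.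
  apply: floor_average_ge => // j Aij; apply: (IH j).1.
  by rewrite leqNgt; apply/negP => rj; have [/negP] := ncross i j ri rj.
apply: floor_average_le => // j Aij; apply: (IH j).2.
by rewrite ltnNge; apply/negP => rj; have [_ /negP] := ncross j i rj ri.
Qed.

(** Each cut is charged once, at its first crossing, when its sides are still separated by at least
    the gap it had at time [b]. *)
Lemma block_decrease (R : realType) (n N B : nat) (eta : R)
    (A : nat -> 'M[R]_n) (z : nat -> 'I_n -> int) (r : 'I_n -> nat)
    (v : nat -> int) (b : nat) (m : int) :
  0 < eta -> nonvanishing_weights eta A -> doubly_stochastic A ->
  floor_iteration A z ->
  (forall p q, (p <= q <= N)%N -> v q <= v p) ->
  (forall i, (r i <= N)%N) -> (forall i, z b i = v (r i)) ->
  (forall i, m <= z b i) ->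
  (forall d, (d < N)%N -> v d = v d.+1 \/
     exists2 t, (t < B)%N & crosses r (A (b + t)%N) d) ->
  \sum_i ((z (b + B)%N i)%:~R - m%:~R : R) ^+ 2
    + eta / 2 * \sum_(d < N) ((v d)%:~R - (v d.+1)%:~R) ^+ 2
  <= \sum_i ((z b i)%:~R - m%:~R) ^+ 2.
Proof.
move=> eta0 hA hdA hz vdec rN zb mz conn.
pose g d : R := ((v d)%:~R - (v d.+1)%:~R) ^+ 2.
have g0 d : 0 <= g d by exact: sqr_ge0.
(* [D t d] means that cut [d] is crossed for the first time in the block at step [b + t]. *)
pose D t d := crosses r (A (b + t)%N) d &&
  [forall u : 'I_t, ~~ crosses r (A (b + u)%N) d].
have mzt := floor_iteration_ge hA hz mz.
have step t : \sum_i ((z (b + t.+1)%N i)%:~R - m%:~R : R) ^+ 2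
      + eta / 2 * \sum_(d < N | D t d) g d
    <= \sum_i ((z (b + t)%N i)%:~R - m%:~R) ^+ 2.
  have [A0 row Aii Aeta] := hA (b + t)%N.
  (* The pair [j], [k] pays for all the cuts first crossed now that separate it: their original gaps
     lie disjointly between the current values of [j] and [k]. *)
  have gap j k : \sum_(d < N | D t d) g d * (separates r d j k)%:R
      <= ((z (b + t)%N j)%:~R - (z (b + t)%N k)%:~R) ^+ 2.
    rewrite (eq_bigr (fun d : 'I_N => if separates r d j k then g d else 0));
      last by move=> d _; case: ifP => _; rewrite ?mulr1 ?mulr0.
    rewrite -big_mkcondr /=.
    have sep d : (d < N)%N -> D t d -> forall i,
        ((r i <= d)%N -> v d <= z (b + t)%N i) /\
        ((d < r i)%N -> z (b + t)%N i <= v d.+1).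
      move=> dN /andP[_ /forallP nc].
      apply: (uncrossed_cut_separates hA hz vdec rN zb dN) => // u ut.
      exact: (nc (Ordinal ut)).
    case: (leqP (r j) (r k)) => rjk; last rewrite -[leRHS]sqrrN opprB.
    - apply: (@sum_sqr_gaps R (fun d => (v d)%:~R)
        (fun d => D t d && separates r d j k)) => [d dN|d dN].
        by rewrite ler_int; apply: vdec; lia.
      move=> /andP[Dd]; rewrite /separates => s; rewrite !ler_int.
      by split; [apply: (sep d dN Dd j).1|apply: (sep d dN Dd k).2]; lia.
    - apply: (@sum_sqr_gaps R (fun d => (v d)%:~R)
        (fun d => D t d && separates r d j k)) => [d dN|d dN].
        by rewrite ler_int; apply: vdec; lia.
      move=> /andP[Dd]; rewrite /separates => s; rewrite !ler_int.
      by split; [apply: (sep d dN Dd k).1|apply: (sep d dN Dd j).2]; lia.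
  have h := @stochastic_step_decrease R 'I_n (fun i j => A (b + t)%N i j)
    (fun j => (z (b + t)%N j)%:~R) (fun j => (z (b + t.+1)%N j)%:~R) m%:~R row
    (hdA (b + t)%N).
  apply: le_trans (h _ _); last 2 first.
  - by move=> i; rewrite ler_int.
  - by move=> i; rewrite addnS hz floor_le.
  rewrite lerD2l [eta / 2]mulrC -mulrA ler_pM2l ?invr_gt0 ?ltr0n //.
  apply: le_trans (_ : \sum_i \sum_j \sum_k A (b + t)%N i j * A (b + t)%N i k *
      \sum_(d < N | D t d) g d * (separates r d j k)%:R <= _); last first.
    do 3!(apply: ler_sum => ? _); apply: ler_wpM2l => //.
    by rewrite mulr_ge0.
  (* With the sum over cuts outermost, [cut_weight_ge] bounds one cut at a time. *)
  apply: le_trans (_ : \sum_(d < N | D t d) g d *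
    (\sum_i \sum_j \sum_k A (b + t)%N i j * A (b + t)%N i k
        * (separates r d j k)%:R) <= _).
    rewrite mulr_sumr; apply: ler_sum => d /andP[cr _].
    by rewrite mulrC ler_wpM2l //; exact: cut_weight_ge.
  rewrite le_eqVlt; apply/orP; left; apply/eqP.
  under eq_bigr do rewrite mulr_sumr.
  rewrite exchange_big; apply: eq_bigr => i _ /=.
  under eq_bigr do rewrite mulr_sumr.
  rewrite exchange_big; apply: eq_bigr => j _ /=.
  under eq_bigr do rewrite mulr_sumr.
  rewrite exchange_big; apply: eq_bigr => k _ /=.
  by rewrite mulr_sumr; apply: eq_bigr => d _; ring.
have total t : \sum_i ((z (b + t)%N i)%:~R - m%:~R : R) ^+ 2
      + eta / 2 * \sum_(u < t) \sum_(d < N | D u d) g d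
    <= \sum_i ((z b i)%:~R - m%:~R) ^+ 2.
  elim: t => [|t IH]; first by rewrite big_ord0 mulr0 addr0 addn0.
  by rewrite big_ord_recr /= mulrDr; have := step t; lra.
apply: le_trans (total B); rewrite lerD2l ler_pM2l ?divr_gt0 ?ltr0n //.
under [leRHS]eq_bigr do rewrite big_mkcond.
rewrite exchange_big; apply: ler_sum => d _ /=.
(* A zero gap contributes nothing; any other cut is crossed, and its first crossing time [t0]
   supplies the term [g d]. *)
have [->|[t tB ct]] := conn d (ltn_ord d).
  by rewrite subrr expr0n sumr_ge0 // => u _; case: ifP.
have ex : exists t, (t < B)%N && crosses r (A (b + t)%N) d.
  by exists t; rewrite tB.
case: (ex_minnP ex) => t0 /andP[t0B ct0] tmin.
rewrite (bigD1 (Ordinal t0B)) //= ifT; last first.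
  rewrite /D ct0; apply/forallP => u; apply/negP => cu.
  have := tmin u; rewrite cu (ltn_trans (ltn_ord u) t0B) => /(_ isT).
  by rewrite leqNgt ltn_ord.
by rewrite lerDl sumr_ge0 // => u _; case: ifP.
Qed.

(** * Ordering the nodes and contracting the sum of squares *)

(** The connectivity hypothesis quantifies over all sorting relabelings, so one must be produced
    before it can be applied. *)
Lemma sorting_relabeling_exists (R : realType) (n : nat) (y : 'cV[R]_n) :
  exists s, sorting_relabeling y s.
Proof.
case: n y => [|n] y; first by exists 1%g => -[].
pose le (i j : 'I_n.+1) := y j 0 <= y i 0.
pose e := sort le (enum 'I_n.+1).
have size_e : size e = n.+1 by rewrite size_sort size_enum_ord.
have nth_inj : injective (fun p : 'I_n.+1 => nth ord0 e p).
  move=> p q /eqP; rewrite nth_uniq ?size_e ?ltn_ord //.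
    by move/eqP/val_inj.
  by rewrite sort_uniq enum_uniq.
exists (perm nth_inj) => p q pq; rewrite !permE.
apply: (@sorted_leq_nth _ le) => //; rewrite ?inE ?size_e ?ltn_ord //.
- by move=> i j k ji ik; exact: le_trans ik ji.
- by move=> i; exact: lexx.
- by apply: sort_sorted => i j; exact: le_total.
Qed.

(** The distance of an entry from the minimum is at most the sum of the [N] gaps. Cauchy-Schwarz
    then bounds the sum of squares by the squared gaps, which turns the additive decrease of
    [block_decrease] into a factor. *)
Lemma block_contraction (R : realType) (N B : nat) (eta : R)
    (A : nat -> 'M[R]_N.+1) (z : nat -> 'I_N.+1 -> int) (b : nat) (m : int)
    (s : 'S_N.+1) :
  0 < eta -> nonvanishing_weights eta A -> doubly_stochastic A ->
  floor_iteration A z ->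
  (forall p q : 'I_N.+1, (p <= q)%N -> z b (s q) <= z b (s p)) ->
  (forall p q : 'I_N.+1, q = p.+1 :> nat -> z b (s p) = z b (s q) \/
    exists (t : nat) (i j : 'I_N.+1),
      [/\ (b <= t < b + B)%N, (i <= p)%N, (q <= j)%N
        & 0 < A t (s i) (s j) \/ 0 < A t (s j) (s i)]) ->
  (exists i, z b i = m) -> (forall i, m <= z b i) ->
  \sum_i ((z (b + B)%N i)%:~R - m%:~R : R) ^+ 2
  <= (1 - eta / (2 * N.+1%:R ^+ 2)) * \sum_i ((z b i)%:~R - m%:~R) ^+ 2.
Proof.
move=> eta0 hA hdA hz srt conn [i0 zi0] mz.
(* Positions are natural numbers so that gaps telescope; [inord p] is the position [p] only for
   [p <= N]. *)
pose r i : nat := (s^-1)%g i.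
pose v p := z b (s (inord p)).
have vr i : z b i = v (r i) by rewrite /v /r inord_val permKV.
have rN i : (r i <= N)%N by rewrite -ltnS /r.
have vdec p q : (p <= q <= N)%N -> v q <= v p.
  by move=> pqN; apply: srt; rewrite !inordK; lia.
have vN : v N = m.
  apply/eqP; rewrite eq_le mz -zi0 vr andbT.
  by apply: vdec; rewrite rN leqnn.
pose gap d : R := (v d)%:~R - (v d.+1)%:~R.
have gap_ge0 d : (d < N)%N -> 0 <= gap d.
  by move=> dN; rewrite subr_ge0 ler_int vdec // leqnSn.
have dec : \sum_i ((z (b + B)%N i)%:~R - m%:~R : R) ^+ 2
    + eta / 2 * \sum_(d < N) gap d ^+ 2 <= \sum_i ((z b i)%:~R - m%:~R) ^+ 2.
  apply: (block_decrease (r := r)) => // d dN.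
  have [|e|[t [i [j [tB id dj cr]]]]] := conn (inord d) (inord d.+1).
  - by rewrite !inordK //; lia.
  - by left.
  - right; exists (t - b)%N; first by lia.
    rewrite subnKC; last by case/andP: tB.
    apply/existsP; exists (s i); apply/existsP; exists (s j).
    move: id dj; rewrite !inordK ?ltnS //; last by lia.
    by rewrite /r !permK => -> -> /=; apply/orP.
have spread_sqr i : ((z b i)%:~R - m%:~R) ^+ 2 <= N%:R * \sum_(d < N) gap d ^+ 2.
  have spreadE : \sum_(d < N) gap d = (v 0%N)%:~R - m%:~R.
    rewrite -(big_mkord xpredT) /= -vN.
    rewrite -opprB -(telescope_sumr (fun d => (v d)%:~R)) // -sumrN.
    by apply: eq_bigr => d _; rewrite opprB.
  apply: le_trans (_ : (\sum_(d < N) gap d) ^+ 2 <= _); last first.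
    by have := sqr_sum_le (fun d : 'I_N => gap d); rewrite card_ord.
  rewrite lerXn2r ?nnegrE ?subr_ge0 ?ler_int ?mz //.
    by apply: sumr_ge0 => d _; exact: gap_ge0.
  by rewrite spreadE lerD2r ler_int vr; apply: vdec; rewrite rN.
have V_le : \sum_i ((z b i)%:~R - m%:~R) ^+ 2
    <= N.+1%:R ^+ 2 * \sum_(d < N) gap d ^+ 2.
  apply: (@le_trans _ _ (\sum_(i < N.+1) N%:R * \sum_(d < N) gap d ^+ 2)).
    by apply: ler_sum.
  rewrite sumr_const card_ord -[leLHS]mulr_natl mulrA ler_wpM2r //.
    by apply: sumr_ge0 => d _; exact: sqr_ge0.
  by rewrite expr2 ler_wpM2l ?ler_nat.
apply: le_trans (_ : _ <= \sum_i ((z b i)%:~R - m%:~R) ^+ 2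
    - eta / 2 * \sum_(d < N) gap d ^+ 2) _; first by rewrite lerBrDr.
rewrite mulrBl mul1r lerD2l lerN2 invfM -!mulrA ler_pM2l // ler_pM2l ?invr_gt0 //.
by rewrite mulrC ler_pdivrMr ?exprn_gt0 ?ltr0n // mulrC.
Qed.

(** * From one block to finite-time consensus *)

(** Uses [1 - q <= expR (- q)] and [D = expR (ln D)]; [q <= 1] keeps the base nonnegative. *)
Lemma geometric_lt1 (R : realType) (q D : R) (l : nat) :
  q <= 1 -> 0 < D -> 2 * ln D < q * l%:R -> (1 - q) ^+ l * D ^+ 2 < 1.
Proof.
move=> q1 D0 h.
have le1 : (1 - q) ^+ l <= expR (- (q * l%:R)).
  rewrite mulrC -mulrN expRM_natl lerXn2r ?nnegrE ?subr_ge0 ?expR_ge0 //.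
  exact: expR_ge1Dx.
apply: le_lt_trans (ler_wpM2r (sqr_ge0 D) le1) _.
rewrite -[D in D ^+ 2]lnK ?posrE // -expRM_natl -expRD -[ltRHS]expR0 ltr_expR.
by rewrite addrC subr_lt0.
Qed.

(** Unit column sums preserve the total before rounding, and each floor loses less than 1. *)
Lemma sum_floor_iteration (R : realType) (n : nat)
    (A : nat -> 'M[R]_n) (z : nat -> 'I_n -> int) :
  doubly_stochastic A -> floor_iteration A z -> forall k,
  \sum_i (z 0%N i)%:~R - n%:R * k%:R <= \sum_i (z k i)%:~R :> R /\
  \sum_i (z k i)%:~R <= \sum_i (z 0%N i)%:~R :> R.
Proof.
move=> hdA hz; elim=> [|k [IH1 IH2]]; first by rewrite mulr0 subr0.
have sumE : \sum_i \sum_j A k i j * (z k j)%:~R = \sum_i (z k i)%:~R :> R.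
  by rewrite exchange_big; apply: eq_bigr => j _; rewrite -mulr_suml hdA mul1r.
have lo : \sum_i (z k i)%:~R - n%:R <= \sum_i (z k.+1 i)%:~R :> R.
  rewrite -sumE -[n in n%:R]card_ord -sum1_card natr_sum -sumrB.
  apply: ler_sum => i _; rewrite hz lerBlDr.
  by have /andP[_ /ltW] := floor_itv (\sum_j A k i j * (z k j)%:~R);
    rewrite intrD.
have hi : \sum_i (z k.+1 i)%:~R <= \sum_i (z k i)%:~R :> R.
  by rewrite -sumE; apply: ler_sum => i _; rewrite hz floor_le.
by rewrite -natr1; lra.
Qed.

Lemma consensus_stable (R : realType) (n : nat) (eta : R)
    (A : nat -> 'M[R]_n) (z : nat -> 'I_n -> int) (m : int) (k : nat) :
  nonvanishing_weights eta A -> floor_iteration A z ->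
  (forall i, z k i = m) -> forall t, (k <= t)%N -> forall i, z t i = m.
Proof.
move=> hA hz zk t /subnKC <-; elim: (t - k)%N => [|u IH] i.
  by rewrite addn0.
have [_ row _ _] := hA (k + u)%N.
rewrite addnS hz; under eq_bigr do rewrite IH.
by rewrite -mulr_suml row mul1r intrKfloor.
Qed.

Lemma rounded_iterateE (R : realType) (n Q : nat) (A : nat -> 'M[R]_n)
    (x : nat -> 'cV[R]_n) :
  (0 < Q)%N -> (forall i, multiple_of_inv Q (x 0%N i 0)) ->
  quantized_iteration Q A x ->
  exists2 z : nat -> 'I_n -> int, floor_iteration A z &
    forall k i, x k i 0 = (z k i)%:~R / Q%:R.
Proof.
move=> Q0 x0 hx; have Qn0 : Q%:R != 0 :> R by rewrite pnatr_eq0 -lt0n.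
(* This floor is exact: at time 0 by hypothesis, later because rounding has produced a multiple of
   [1/Q]. *)
pose z k i := Num.floor (x k i 0 * Q%:R).
have xz k i : x k i 0 = (z k i)%:~R / Q%:R.
  case: k => [|k]; last first.
    by rewrite /z hx !mxE /round_down divfK // intrKfloor.
  by rewrite /z; have [h ->] := x0 i; rewrite divfK // intrKfloor.
exists z => // k i; rewrite {1}/z hx !mxE /round_down divfK // intrKfloor.
rewrite mulr_suml; congr Num.floor; apply: eq_bigr => j _.
by rewrite xz -mulrA divfK.
Qed.

(** The reference value [m] is renewed at each block, since [block_contraction] requires it to be
    the attained minimum. *)
Lemma blocks_contraction (R : realType) (N B Q : nat) (eta : R)
    (A : nat -> 'M[R]_N.+1) (x : nat -> 'cV[R]_N.+1)
    (z : nat -> 'I_N.+1 -> int) (m0 : int) :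
  (0 < Q)%N -> 0 < eta -> nonvanishing_weights eta A ->
  doubly_stochastic A -> floor_iteration A z ->
  (forall k i, x k i 0 = (z k i)%:~R / Q%:R) ->
  relaxed_connectivity B A x ->
  (exists i, z 0%N i = m0) -> (forall i, m0 <= z 0%N i) ->
  forall l, exists m : int, [/\ exists i, z (l * B)%N i = m,
    forall i, m <= z (l * B)%N i &
    \sum_i ((z (l * B)%N i)%:~R - m%:~R) ^+ 2 <=
      (1 - eta / (2 * N.+1%:R ^+ 2)) ^+ l *
      \sum_i ((z 0%N i)%:~R - m0%:~R : R) ^+ 2].
Proof.
move=> Q0 eta0 hA hdA hz xz conn z0 m0z.
have Qr0 : 0 < Q%:R :> R by rewrite ltr0n.
have xz_le k i j : (x k i 0 <= x k j 0) = (z k i <= z k j).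
  by rewrite !xz ler_pM2r ?invr_gt0 // ler_int.
(* A diagonal entry exceeds [eta] and is at most 1, so the contraction factor is nonnegative and the
   bounds can be multiplied. *)
have q1 : 0 <= 1 - eta / (2 * N.+1%:R ^+ 2).
  have [A0 row Aii Aeta] := hA 0%N.
  have eta1 : eta <= 1.
    rewrite -(row ord0) (bigD1 ord0) //=; apply: ler_wpDr.
      by apply: sumr_ge0.
    by apply/ltW/Aeta.
  rewrite subr_ge0 ler_pdivrMr ?mul1r ?mulr_gt0 ?exprn_gt0 ?ltr0n //.
  apply: le_trans eta1 _; rewrite -natrX -natrM ler1n.
  by rewrite muln_gt0 expn_gt0.
elim=> [|l [m [[i zi] mz IH]]].
  by exists m0; split => //; rewrite expr0 mul1r.
have [s srt] := sorting_relabeling_exists (x (l * B)%N).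
have lB : (l.+1 * B = l * B + B)%N by rewrite mulSn addnC.
have contr := @block_contraction R N B eta A z (l * B)%N m s eta0 hA hdA hz.
have {}contr : \sum_i ((z (l.+1 * B)%N i)%:~R - m%:~R : R) ^+ 2
    <= (1 - eta / (2 * N.+1%:R ^+ 2))
       * \sum_i ((z (l * B)%N i)%:~R - m%:~R) ^+ 2.
  rewrite lB; apply: contr => //; last by exists i.
    by move=> p q pq; rewrite -xz_le; exact: srt.
  move=> p q pq; have [e|h] := conn l s srt p q pq; [left|right].
    by apply/eqP; rewrite eq_le -!xz_le e lexx.
  by rewrite -lB.
pose i' := [arg min_(j < ord0) z (l.+1 * B)%N j]%O.
have m'le j : z (l.+1 * B)%N i' <= z (l.+1 * B)%N j.
  by rewrite /i'; case: arg_minP => // k _; apply.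
exists (z (l.+1 * B)%N i'); split => //; first by exists i'.
(* The new minimum is at least [m], so measuring from it only shrinks each square. *)
apply: le_trans (_ : _ <= \sum_i ((z (l.+1 * B)%N i)%:~R - m%:~R : R) ^+ 2) _.
  apply: ler_sum => j _; rewrite lerXn2r ?nnegrE ?subr_ge0 ?ler_int //.
    by rewrite lB; apply: floor_iteration_ge hA hz mz _ _.
  by rewrite lerD2l lerN2 ler_int lB; apply: floor_iteration_ge hA hz mz _ _.
apply: le_trans contr _.
by rewrite [_ ^+ l.+1]exprS -mulrA ler_wpM2l.
Qed.

(** * The estimate for the common limit *)

Unset Implicit Arguments.

Theorem proposition7p4 (R : realType) :
  exists c : R, 0 < c /\
  forall (n B Q : nat) (eta : R) (A : nat -> 'M[R]_n) (x : nat -> 'cV[R]_n)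
         (U L : R),
    (1 <= n)%N -> (1 <= B)%N -> (1 <= Q)%N -> 0 < eta ->
    nonvanishing_weights eta A ->
    doubly_stochastic A ->
    (forall i, multiple_of_inv Q (x 0%N i 0)) ->
    quantized_iteration Q A x ->
    relaxed_connectivity B A x ->
    is_max (x 0%N) U -> is_min (x 0%N) L -> L < U ->
    exists xf : R,
      (forall i, x k i 0 @[k --> \oo] --> xf) /\
      `| xf - (\sum_i x 0%N i 0) / n%:R |
        <= c / Q%:R * (n%:R ^+ 2 / eta) * B%:R
             * ln (Q%:R * n%:R * (U - L)).
Proof.
(* More than [4 * X] blocks are needed; rounding up costs at most 1, which [X1] absorbs into
   [5 * X]. *)
exists 5; split=> // n B Q eta A x U L n_gt0 B_gt0 Q_gt0 eta0 hA hdA x0 hx conn.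
move=> [[iU xU] leU] [[iL xL] leL] LU.
case: n n_gt0 A x iU xU leU iL xL leL hA hdA x0 hx conn => // N _.
move=> A x iU xU leU iL xL leL hA hdA x0 hx conn.
have Q0 : 0 < Q%:R :> R by rewrite ltr0n.
have n0 : 0 < N.+1%:R :> R by rewrite ltr0n.
have [z hz xz] := rounded_iterateE Q_gt0 x0 hx.
pose w := Q%:R * (U - L).
have wE : w = (z 0%N iU)%:~R - (z 0%N iL)%:~R.
  by rewrite /w -xU -xL !xz -mulrBl mulrC divfK ?gt_eqF.
(* The scaled range [w] is a positive integer. *)
have w1 : 1 <= w.
  have : 0 < w by rewrite mulr_gt0 // subr_gt0.
  by rewrite wE -rmorphB /= -[0]/(0%:~R) -[1]/(1%:~R) ltr_int ler_int.
have n2 : 2 <= N.+1%:R :> R.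
  rewrite ler_nat ltnS lt0n; apply/eqP => N0; subst N.
  by move: LU; rewrite -xU -xL (ord1 iU) (ord1 iL) ltxx.
pose D := Q%:R * N.+1%:R * (U - L).
have DE : D = N.+1%:R * w by rewrite /D /w; ring.
have D2 : 2 <= D by rewrite DE; nra.
have D0 : 0 < D by lra.
(* From [ln y <= y - 1] at [y = D^-1], with [D^-1 <= 2^-1]. *)
have lnD : 2^-1 <= ln D.
  have Dinv : 0 < D^-1 by rewrite invr_gt0.
  have := @le_ln1Dx R (D^-1 - 1); rewrite (_ : 1 + _ = D^-1); last by ring.
  have /[swap]/[apply] : -1 < D^-1 - 1 by lra.
  rewrite lnV ?posrE //; have : D^-1 <= 2^-1 by rewrite lef_pV2 ?posrE.
  by lra.
pose q := eta / (2 * N.+1%:R ^+ 2).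
have eta1 : eta <= 1.
  have [A0 row Aii Aeta] := hA 0%N.
  rewrite -(row ord0) (bigD1 ord0) //=; apply: ler_wpDr; first exact: sumr_ge0.
  exact/ltW/Aeta.
pose X := N.+1%:R ^+ 2 / eta * ln D.
have X1 : 1 <= X.
  have : 4 <= N.+1%:R ^+ 2 / eta by rewrite ler_pdivlMr //; nra.
  by rewrite /X; nra.
(* The threshold [2 * ln D / q] of [geometric_lt1] equals [4 * X]; the successor makes the
   inequality strict. *)
pose l := (Num.truncn (4 * X)).+1.
have l_gt : 4 * X < l%:R := truncnS_gt _.
have l_le : l%:R <= 5 * X.
  have := @truncn_itv R (4 * X); rewrite /l -natr1 => /(_ _)/andP[|]; first lra.
  by move=> ? _; lra.
have leL' i : z 0%N iL <= z 0%N i.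
  by have := leL i; rewrite -xL !xz ler_pM2r ?invr_gt0 // ler_int.
have leU' i : z 0%N i <= z 0%N iU.
  by have := leU i; rewrite -xU !xz ler_pM2r ?invr_gt0 // ler_int.
have V0 : \sum_i ((z 0%N i)%:~R - (z 0%N iL)%:~R : R) ^+ 2 <= D ^+ 2.
  apply: le_trans (_ : \sum_(i < N.+1) w ^+ 2 <= _).
    apply: ler_sum => i _; rewrite lerXn2r ?nnegrE ?subr_ge0 ?ler_int //; first lra.
    by rewrite wE lerD2r ler_int.
  rewrite sumr_const card_ord -[leLHS]mulr_natl DE [in leRHS]exprMn.
  by rewrite ler_wpM2r ?sqr_ge0 // expr2; nra.
have [m [_ mz Vm]] := blocks_contraction Q_gt0 eta0 hA hdA hz xz conn
  (ex_intro _ iL erefl) leL' l.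
have q1 : q <= 1.
  rewrite ler_pdivrMr ?mul1r ?mulr_gt0 ?exprn_gt0 //; nra.
have Vlt1 : \sum_i ((z (l * B)%N i)%:~R - m%:~R : R) ^+ 2 < 1.
  apply: le_lt_trans Vm _.
  apply: le_lt_trans (_ : (1 - q) ^+ l * D ^+ 2 < 1).
    by rewrite ler_wpM2l // exprn_ge0 // subr_ge0.
  apply: geometric_lt1 => //.
  rewrite -ltr_pdivrMl ?divr_gt0 ?mulr_gt0 ?exprn_gt0 //.
  rewrite (_ : _ * _ = 4 * X) // /q /X invf_div; ring.
(* Each integer [z (l * B)%N i] is at least [m] and at squared distance below 1 from it. *)
have zm i : z (l * B)%N i = m.
  apply/eqP; rewrite eq_le mz andbT -ltzD1 -(ltr_int R) intrD -ltrBlDl.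
  rewrite -(@ltr_pXn2r _ 2) ?nnegrE ?subr_ge0 ?ler_int // expr1n.
  apply: le_lt_trans Vlt1; rewrite (bigD1 i) //= lerDl.
  by apply: sumr_ge0 => ? _; exact: sqr_ge0.
exists (m%:~R / Q%:R); split.
  move=> i; apply: cvg_near_cst; exists (l * B)%N => // k /= lBk.
  by rewrite xz (consensus_stable hA hz zm lBk).
have [lo hi] := sum_floor_iteration hdA hz (l * B)%N.
have smE : \sum_i (z (l * B)%N i)%:~R = N.+1%:R * m%:~R :> R.
  by under eq_bigr do rewrite zm; rewrite sumr_const card_ord mulr_natl.
rewrite smE in lo hi.
set S := \sum_i (z 0%N i)%:~R in lo hi.
have -> : (\sum_i x 0%N i 0) / N.+1%:R = S / N.+1%:R / Q%:R.
  under eq_bigr do rewrite xz.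
  by rewrite -mulr_suml -/S mulrAC.
rewrite -mulrBl normrM [ `|Q%:R^-1| ]gtr0_norm ?invr_gt0 //.
rewrite -/D.
have -> : 5 / Q%:R * (N.+1%:R ^+ 2 / eta) * B%:R * ln D = 5 * X * B%:R / Q%:R.
  by rewrite /X; ring.
rewrite ler_pM2r ?invr_gt0 //.
(* The sum drops by at most [N.+1] in each of the [l * B] steps, so the average drops by at most
   [l * B]. *)
apply: le_trans (_ : l%:R * B%:R <= _); last by rewrite ler_wpM2r.
rewrite -natrM ler0_norm; last by rewrite subr_le0 ler_pdivlMr // mulrC.
rewrite opprB lerBlDr ler_pdivrMr //; lra.
Qed.
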